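(* Denote by $1_{(u,w)}$ the shape in a ray that consists of the interval $(u,w)$, and let $g$ be a projection function that has the independence property and is scale invariant (both defined in the context) and that satisfies the condition $$g\big(1_{(1,e)}\big)=e^{\alpha}\qquad\text{for some } \alpha<0 .$$ Let $v$ be a 3D continuous shape, and let $$\ell_v(\vec{x}) \triangleq \int_0^{\infty}\frac{v_{R(\vec{x})}(r)}{r}\,dr=\int_0^{\infty}\frac{v(\vec{c}+r\vec{x})}{r}\,dr$$ be a measure of the ''mass'' in the ray $R(\vec{x})$. Then the projection function $g$ must have the form $$g\big(v_{R(\vec{x})}\big)=e^{\alpha\,\ell_v(\vec{x})}.$$
   Context: Continuous shapes. Given a set $\Omega\subset\mathbb{R}^d$, a set $s\subset\Omega$ is a continuous shape if it is open and its boundary has zero measure. It is also regarded as the function $s:\Omega\to\{0,1\}$ equal to $1$ on $s$ and $0$ elsewhere. Camera and rays. $\vec{c}\in\mathbb{R}^3$ is the camera center, $\Theta\subset S^2$ (a subset of the unit sphere) is the image domain, and $\Phi\subset\mathbb{R}^3$ is the set of points $\vec{c}+r\vec{x}$ with $\vec{x}\in\Theta$ and $R_{min}\le r\le R_{max}$. The ray of $\vec{x}\in\Theta$ is $R(\vec{x})=\{\vec{X}\in\Phi:\vec{X}=\vec{c}+r\vec{x},\ r\in[0,\infty)\}$. A 3D continuous shape $v$ is a continuous shape in $\Phi$ (so $v$ is $0$ outside $\Phi$). The shape $v$ in the ray $R(\vec{x})$, written $v_{R(\vec{x})}$, is the 1D continuous shape defined by $v_{R(\vec{x})}(r)\triangleq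 v(\vec{c}+r\vec{x})$. More generally, a shape in a ray, $v_R$, is a 1D continuous shape, a function of the distance $r$ to the camera center. Projection function. A projection function $g$ assigns to a shape in a ray $v_{R(\vec{x})}$ the probability $g(v_{R(\vec{x})})\triangleq P(q(\vec{x})=0\,|\,v_{R(\vec{x})})$ of seeing the background (i.e., not the shape $v$) at $\vec{x}$ given the shape $v_{R(\vec{x})}$ in the ray; here $q(\vec{x})\in\{0,1\}$ is the state (0 = background, 1 = foreground) of the image point $\vec{x}$. Independence property. $g$ has the independence property if, for any two continuous shapes $v^1_R$ and $v^2_R$ in the same ray $R$ that are disjoint ($v^1_R\cap v^2_R=\emptyset$), $g(v^1_R\cup v^2_R)=g(v^1_R)\,g(v^2_R)$. Scale invariance. $g$ is scale invariant if, for any shape in a ray $v_R$, $g(v_R(r))=g(v_R(Sr))$ for all $S>0$, i.e., the shapes $r\mapsto v_R(r)$ and $r\mapsto v_R(Sr)$ have the same value of $g$.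
   Formalization: Adds that g takes equal values on shapes in a ray differing by a null set (else g could also penalize the number of components) and that R_min > 0 (else g could vanish on finite-mass shapes accumulating at the camera center); without either the claim is false. *)

(* Defs.v *)
From mathcomp Require Import all_boot all_order all_algebra.
From mathcomp Require Import all_classical all_reals all_analysis.
Set Implicit Arguments.
Unset Strict Implicit.
Unset Printing Implicit Defensive.
Import Order.TTheory GRing.Theory Num.Theory.
Import numFieldNormedType.Exports.
Local Open Scope classical_set_scope.
Local Open Scope ring_scope.

(* R^3 is the product R * R * R, with
   the product topology and the product Lebesgue measure. *)

Definition boundary (T : topologicalType) (s : set T) : set T :=
  closure s `\` interior s.

(* Openness and boundary are those of the ambient space, not of Omega; the
   predicate null says which sets of the ambient space have zero measure. *)
Definition continuous_shape (T : topologicalType) (null : set T -> Prop)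
    (Omega s : set T) : Prop :=
  [/\ s `<=` Omega, open s & null (boundary s)].

Definition null1 (R : realType) (A : set R) : Prop :=
  (@lebesgue_measure R).-negligible A.

Definition null3 (R : realType) (A : set (R * R * R)) : Prop :=
  (@lebesgue_measure R \x @lebesgue_measure R \x @lebesgue_measure R)%E
    .-negligible A.

(* Spelled out because the library's norm on products is the max norm. *)
Definition unit_sphere (R : realType) : set (R * R * R) :=
  [set x | x.1.1 ^+ 2 + x.1.2 ^+ 2 + x.2 ^+ 2 = 1].

(* The set Phi seen by a camera with center c and image domain Theta. *)
Definition visible_region (R : realType) (c : R * R * R)
    (Theta : set (R * R * R)) (Rmin Rmax : R) : set (R * R * R) :=
  [set X | exists x r, [/\ Theta x, Rmin <= r <= Rmax & X = c + r *: x]].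

Definition shape3 (R : realType) (c : R * R * R) (Theta : set (R * R * R))
    (Rmin Rmax : R) (v : set (R * R * R)) : Prop :=
  continuous_shape (@null3 R) (visible_region c Theta Rmin Rmax) v.

(* A shape in a ray is a set of distances to the camera center. *)
Definition ray_shape (R : realType) (s : set R) : Prop :=
  continuous_shape (@null1 R) `[0, +oo[%classic s.

Definition interval_shape (R : realType) (u w : R) : set R := `]u, w[%classic.

Definition shape_in_ray (R : realType) (v : set (R * R * R))
    (c x : R * R * R) : set R :=
  [set r | 0 <= r /\ v (c + r *: x)].

(* A projection function maps a shape in a ray to a probability. It is
   represented by a total map on sets; this and the following predicates only
   constrain its values on shapes in a ray. *)
Definition projection_function (R : realType) (g : set R -> R) : Prop :=
  forall s, ray_shape s -> 0 <= g s <= 1.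

(* Shapes in a ray that differ by a null set are not distinguished: for
   instance `]1, 3[ and `]1, 2[ `|` `]2, 3[ have the same image. *)
Definition null_invariant (R : realType) (g : set R -> R) : Prop :=
  forall s t, ray_shape s -> ray_shape t ->
    null1 ((s `\` t) `|` (t `\` s)) -> g s = g t.

Definition independence_property (R : realType) (g : set R -> R) : Prop :=
  forall s t, ray_shape s -> ray_shape t -> s `&` t = set0 ->
    g (s `|` t) = g s * g t.

(* [set r | s (S * r)] is the shape with indicator r |-> s (S r). *)
Definition scale_invariant (R : realType) (g : set R -> R) : Prop :=
  forall s, ray_shape s ->
    forall S, 0 < S -> g s = g [set r | s (S * r)].

(* The integrand takes the value 0 at r = 0, since x / 0 = 0 here. *)
Definition ray_mass (R : realType) (v : set (R * R * R)) (c x : R * R * R) :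
    \bar R :=
  (\int[@lebesgue_measure R]_(r in `[0%R, +oo[)
     (\1_(shape_in_ray v c x) r / r)%:E)%E.

(* Main.v *)
(** Write m(s) for the integral of 1/r over s. Independence and scale invariance
    make u |-> g(]1, e^u[) multiplicative; independence and null invariance make
    g antitone for inclusion. So g(]u, w[) = (w/u)^alpha = e^(alpha m(]u, w[)).
    For a shape s in ]a, b[ and a closed K in s, the inequality
    g(s & ]u, w[) <= e^(alpha m(K & ]u, w[)) is inherited by concatenating
    intervals and holds for small intervals around any point (in s by the
    interval formula, outside s because K is avoided and g <= 1). Hence it holds
    on ]a, b[, and inner regularity gives g(s) <= e^(alpha m(s)). The same
    bound for the complementary shape s' = ]a, b[ \ closure s, together with
    g(s) g(s') = g(]a, b[) and m(s) + m(s') = m(]a, b[), forces equality. *)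

Require Import Defs.
From mathcomp Require Import all_boot all_order all_algebra.
From mathcomp Require Import all_classical all_reals all_analysis.
From mathcomp Require Import measurable_realfun.
From mathcomp Require Import ring lra.
Set Implicit Arguments.
Unset Strict Implicit.
Import Order.TTheory GRing.Theory Num.Theory.
Import numFieldNormedType.Exports.
Local Open Scope classical_set_scope.
Local Open Scope ring_scope.

(** * Topological boundaries under set operations *)

Section Boundary.
Context {T : topologicalType}.
Implicit Types s t : set T.

Lemma boundaryE s : boundary s = closure s `&` closure (~` s).
Proof. by rewrite /boundary closure_setC. Qed.

Lemma boundaryC s : boundary (~` s) = boundary s.
Proof. by rewrite !boundaryE setCK setIC. Qed.

Lemma boundaryU s t : boundary (s `|` t) `<=` boundary s `|` boundary t.
Proof.
rewrite !boundaryE closureU setCU => p [st /closureI[ps pt]].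
by case: st => ?; [left|right].
Qed.

Lemma boundaryI s t : boundary (s `&` t) `<=` boundary s `|` boundary t.
Proof.
rewrite -boundaryC setCI => p /boundaryU.
by rewrite !boundaryC.
Qed.

Lemma boundary_closure s : boundary (closure s) `<=` boundary s.
Proof.
rewrite !boundaryE => p [].
rewrite -(closure_id _).1; last exact: closed_closure.
move=> ps pC; split=> //; apply: closure_subset pC; apply: subsetC.
exact: subset_closure.
Qed.

End Boundary.

(** * The mass of a set of distances for the measure dr/r *)

Section LogMass.
Context {R : realType}.
Notation mu := (@lebesgue_measure R).
Implicit Types (A B : set R) (a b u w : R).

(** Real-valued, so an infinite integral would be sent to 0; sets are therefore kept inside some
    [[a, b]] with [0 < a]. *)
Definition log_mass A : R := \int[mu]_(r in A) r^-1.

Lemma inv_integrable a b A : 0 < a -> measurable A -> A `<=` `[a, b] ->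
  mu.-integrable A (EFin \o (fun r : R => r^-1)).
Proof.
move=> a0 mA Aab; apply: (@integrableS _ _ _ mu `[a, b]%classic) => //.
apply: continuous_compact_integrable; first exact: segment_compact.
apply/continuous_in_subspaceT => r; rewrite inE/= in_itv/= => /andP[ar _].
by apply: inv_continuous; rewrite gt_eqF// (lt_le_trans a0).
Qed.

Lemma log_massU a b A B : 0 < a -> measurable A -> measurable B ->
  A `<=` `[a, b] -> B `<=` `[a, b] -> A `&` B = set0 ->
  log_mass (A `|` B) = log_mass A + log_mass B.
Proof.
move=> a0 mA mB Aab Bab AB0; rewrite /log_mass Rintegral_setU//.
- apply: (@inv_integrable a b) => //; first exact: measurableU.
  by rewrite subUset.
- by apply/disj_setPS; rewrite AB0.
Qed.

Lemma log_mass_ge0 a b A : 0 < a -> A `<=` `[a, b] -> 0 <= log_mass A.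
Proof.
move=> a0 Aab; apply: Rintegral_ge0 => r /Aab/=.
rewrite in_itv/= => /andP[ar _].
by rewrite invr_ge0 (le_trans (ltW a0)).
Qed.

(** The bound [r^-1 <= a^-1] turns small Lebesgue measure into small mass, for null sets and for
    inner approximation alike. *)
Lemma log_mass_le a b A : 0 < a -> measurable A -> A `<=` `[a, b] ->
  log_mass A <= a^-1 * fine (mu A).
Proof.
move=> a0 mA Aab; rewrite -Rintegral_cst//; apply: le_Rintegral => //.
- exact: (@inv_integrable a b).
- apply: (@integrableS _ _ _ mu `[a, b]%classic) => //.
  apply: continuous_compact_integrable; first exact: segment_compact.
  by apply: continuous_subspaceT => ?; exact: cst_continuous.
- move=> r /Aab/=; rewrite in_itv/= => /andP[ar _].
  by rewrite lef_pV2// posrE// (lt_le_trans a0).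
Qed.

Lemma log_mass_null a b A : 0 < a -> measurable A -> A `<=` `[a, b] ->
  null1 A -> log_mass A = 0.
Proof.
move=> a0 mA Aab nA; apply/eqP.
have A0 : mu A = 0%E by exact: measure_negligible.
rewrite eq_le (@log_mass_ge0 a b)// andbT.
by have := @log_mass_le a b A a0 mA Aab; rewrite A0 mulr0.
Qed.

Lemma log_mass_itv u w : 0 < u -> u <= w ->
  log_mass `]u, w[ = ln w - ln u.
Proof.
move=> u0; rewrite le_eqVlt => /predU1P[<-|uw].
  by rewrite set_itvoo0 subrr /log_mass Rintegral_set0.
have iuw : mu.-integrable `[u, w] (EFin \o (fun r : R => r^-1)).
  exact: (@inv_integrable u w).
(* The fundamental theorem is applied on the closed interval, so the endpoints, which carry no mass,
   are added first. *)
rewrite /log_mass Rintegral_itv_obnd_cbnd; last first.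
  by apply: integrableS iuw => //; exact: subset_itv_oo_cc.
rewrite Rintegral_itv_bndo_bndc; last first.
  by apply: integrableS iuw => //; exact: subset_itv_co_cc.
rewrite /Rintegral (@continuous_FTC2 _ _ (@ln R) u w uw)//.
- apply/continuous_in_subspaceT => r; rewrite inE/= in_itv/= => /andP[ur _].
  by apply: inv_continuous; rewrite gt_eqF// (lt_le_trans u0).
- split.
  + move=> r; rewrite in_itv/= => /andP[ur _].
    by apply: ex_derive; apply: is_derive1_ln; exact: lt_trans ur.
  + by apply: cvg_at_right_filter; exact: continuous_ln.
  + by apply: cvg_at_left_filter; apply: continuous_ln; exact: lt_trans uw.
- move=> r; rewrite in_itv/= => /andP[ur _].
  rewrite derive1E; apply: derive_val; apply: is_derive1_ln.
  exact: lt_trans ur.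
Qed.

End LogMass.

(** * Null sets and stability of shapes in a ray *)

Section RayShape.
Context {R : realType}.
Implicit Types s t : set R.

Lemma null1S s t : s `<=` t -> null1 t -> null1 s.
Proof. by rewrite /null1 => st; exact: negligibleS. Qed.

Lemma null1U s t : null1 s -> null1 t -> null1 (s `|` t).
Proof. by rewrite /null1; exact: negligibleU. Qed.

Lemma null1_set0 : null1 (@set0 R).
Proof. exact: negligible_set0. Qed.

Lemma null1_set1 (u : R) : null1 [set u].
Proof. by exists [set u]; split=> //; exact: lebesgue_measure_set1. Qed.

Lemma ray_shape_measurable s : ray_shape s -> measurable s.
Proof. by case=> _ os _; exact: open_measurable. Qed.

Lemma ray_shapeU s t : ray_shape s -> ray_shape t -> ray_shape (s `|` t).
Proof.
move=> [s0 os ns] [t0 ot nt]; split; first by rewrite subUset.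
- exact: openU.
- exact: null1S (@boundaryU _ s t) (null1U ns nt).
Qed.

Lemma ray_shapeI s t : ray_shape s -> ray_shape t -> ray_shape (s `&` t).
Proof.
move=> [s0 os ns] [t0 ot nt]; split; first by move=> r [/s0].
- exact: openI.
- exact: null1S (@boundaryI _ s t) (null1U ns nt).
Qed.

(** Removing [closure t] instead of [t] keeps the result open, at the cost of the null boundary of
    [t] only. *)
Lemma ray_shapeD s t : ray_shape s -> ray_shape t ->
  ray_shape (s `\` closure t).
Proof.
move=> [s0 os ns] [t0 ot nt]; split; first by move=> r [/s0].
- by apply: openI => //; apply: closed_openC; exact: closed_closure.
- apply: null1S (null1U ns nt) => r /boundaryI[|]; first by left.
  by rewrite boundaryC => /boundary_closure; right.
Qed.

Lemma ray_shape_itv (u w : R) : 0 <= u -> ray_shape `]u, w[%classic.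
Proof.
move=> u0; split.
- move=> r /=; rewrite !in_itv/= andbT => /andP[ur _].
  by rewrite (le_trans u0)// ltW.
- exact: interval_open.
- apply: null1S (null1U (null1_set1 u) (null1_set1 w)).
  rewrite boundaryE => r [].
  have cuw : closed `[u, w]%classic by exact: interval_closed.
  move=> /(closure_subset (@subset_itv_oo_cc _ _ u w)).
  rewrite -(closure_id _).1//= in_itv/= => /andP[ur rw].
  rewrite closure_setC => ruw.
  have [->|ru] := eqVneq r u; first by left.
  have [->|rw'] := eqVneq r w; first by right.
  exfalso; apply: ruw; rewrite (interior_id _).1 ?interval_open//=.
  by rewrite in_itv/= !lt_neqAle ur rw rw' eq_sym ru.
Qed.

End RayShape.

(** * A functional equation and a covering principle on the real line *)

Section RealLemmas.
Context {R : realType}.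

(** Cauchy's functional equation, with monotonicity in place of continuity: [f u ^+ n], which is
    [f (n%:R * u)], lies between the values of [f] at consecutive integers. *)
Lemma antitone_morphism_expR (f : R -> R) (alpha : R) :
  (forall u w, 0 <= u -> 0 <= w -> f (u + w) = f u * f w) ->
  (forall u w, 0 <= u -> u <= w -> f w <= f u) ->
  f 1 = expR alpha ->
  forall u, 0 <= u -> f u = expR (alpha * u).
Proof.
move=> fD fle f1 u u0.
have f0 : f 0 = 1.
  have := fD 0 1 (lexx _) ler01; rewrite add0r => /esym/eqP.
  rewrite -subr_eq0 -[X in _ - X]mul1r -mulrBl mulf_eq0 subr_eq0.
  by rewrite f1 (gt_eqF (expR_gt0 _)) orbF => /eqP.
have fX w n : 0 <= w -> f (n%:R * w) = f w ^+ n.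
  move=> w0; elim: n => [|n IHn]; first by rewrite mul0r f0 expr0.
  by rewrite exprS -IHn -natr1 mulrDl mul1r addrC fD// mulr_ge0.
have fn n : f n%:R = expR (alpha * n%:R).
  by rewrite -[in LHS](mulr1 n%:R) fX// f1 -expRM_natr.
have a0 : alpha <= 0.
  by rewrite -ler_expR expR0 -f1 -[leRHS]f0; exact: fle.
have bracket n : expR (alpha * (Num.truncn (n%:R * u)).+1%:R) <= f u ^+ n
                   <= expR (alpha * (Num.truncn (n%:R * u))%:R).
  have nu0 : 0 <= n%:R * u by rewrite mulr_ge0.
  have /andP[kle klt] := truncn_itv nu0.
  by rewrite -fX// -!fn !fle// ltW.
have fu0 : 0 < f u.
  have /andP[le1 _] := bracket 1%N.
  by rewrite -[f u]expr1; apply: lt_le_trans le1; exact: expR_gt0.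
rewrite -[f u]lnK ?posrE//; congr expR; apply/eqP; rewrite -subr_eq0 -normr_eq0.
apply/negPn/negP => d0.
have {}d0 : 0 < `|ln (f u) - alpha * u|
  by rewrite lt_neqAle eq_sym d0 normr_ge0.
set d := `|_| in d0.
(* This [n] satisfies [- alpha < n * d], whereas its bracket gives [n * d <= - alpha]. *)
set n := (Num.truncn (- alpha / d)).+1.
have : - alpha / d < n%:R by exact: truncnS_gt.
rewrite ltr_pdivrMr// ltNge => /negP; apply.
have /andP[] := bracket n.
rewrite -[f u]lnK ?posrE// -expRM_natr !ler_expR.
have nu0 : 0 <= n%:R * u by rewrite mulr_ge0.
have /andP[kle klt] := truncn_itv nu0.
have h3 := ler_wnM2l a0 kle; have h4 := ler_wnM2l a0 (ltW klt).
move: h4; rewrite -natr1 => h4 h1 h2.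
rewrite /d -[n%:R]ger0_norm// -normrM ler_norml.
apply/andP; split; lra.
Qed.

(** Cousin's principle, by real induction: the supremum of the [w] with [P a w] is attained and
    cannot lie below [b]. Local intervals need only contain their tag [p]. *)
Lemma cousin (a b : R) (P : R -> R -> Prop) : a <= b ->
  (forall u m w, a <= u -> u <= m -> m <= w -> w <= b ->
    P u m -> P m w -> P u w) ->
  (forall p, a <= p <= b -> exists2 d, 0 < d &
    forall u w, a <= u -> p - d < u -> u <= p -> p <= w -> w < p + d ->
      w <= b -> P u w) ->
  P a b.
Proof.
move=> ab PD Ploc.
pose A := [set w | a <= w <= b /\ P a w].
have Aa : A a.
  split; first by rewrite lexx ab.
  have [|d d0] := Ploc a; first by rewrite lexx ab.
  by apply; rewrite // ?ltrBlDr ltrDl.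
have Aub : has_ubound A by exists b => w [/andP[]].
have Asup : has_sup A by split=> //; exists a.
have pab : a <= sup A <= b.
  rewrite ub_le_sup//=; apply: ge_sup; first by exists a.
  by move=> w [/andP[]].
have [d d0 Pd] := Ploc _ pab.
have [w [/andP[aw wb] Paw] pdw] := sup_adherent d0 Asup.
have wp : w <= sup A by apply: ub_le_sup => //; split=> //; rewrite aw wb.
have /andP[ap pb] := pab.
(* Some admissible [w] lies just left of the supremum; the interval from [w] to [w'] contains the
   supremum, so it is covered by the local hypothesis. *)
have extend w' : sup A <= w' -> w' < sup A + d -> w' <= b -> P a w'.
  move=> pw' w'd w'b; apply: (PD a w w') => //; first exact: le_trans pw'.
  exact: Pd.
(* Half of [d], because the local hypothesis asks for a strict [w < p + d]. *)
have [bp|pltb] := lerP b (sup A + d / 2).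
  apply: extend => //; rewrite (le_lt_trans bp)// ltrD2l.
  by rewrite ltr_pdivrMr// ltr_pMr// ltr1n.
have : sup A + d / 2 <= sup A.
  apply: ub_le_sup => //; split; last first.
    apply: extend; rewrite ?lerDl ?divr_ge0 ?(ltW d0)// ?ltW//.
    by rewrite ltrD2l ltr_pdivrMr// ltr_pMr// ltr1n.
  by rewrite (ltW pltb) andbT (le_trans ap)// lerDl divr_ge0// ltW.
by rewrite gerDl leNgt divr_gt0.
Qed.
End RealLemmas.

(** * Additivity and monotonicity of the mass, up to null sets *)

Section LogMassSplit.
Context {R : realType}.
Implicit Types (s t : set R) (a b : R).

Lemma log_mass_split a b t s1 s2 : 0 < a -> t `<=` `[a, b] ->
  measurable t -> measurable s1 -> measurable s2 -> s1 `<=` t -> s2 `<=` t ->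
  s1 `&` s2 = set0 -> null1 (t `\` (s1 `|` s2)) ->
  log_mass t = log_mass s1 + log_mass s2.
Proof.
move=> a0 tab mt m1 m2 s1t s2t s12 n12.
have s1ab := subset_trans s1t tab; have s2ab := subset_trans s2t tab.
have m12 : measurable (s1 `|` s2) by exact: measurableU.
have mD : measurable (t `\` (s1 `|` s2)) by exact: measurableD.
rewrite -(log_massU a0 m1 m2 s1ab s2ab s12).
have Dab : t `\` (s1 `|` s2) `<=` `[a, b] by move=> r [/tab].
have -> : log_mass t = log_mass ((s1 `|` s2) `|` (t `\` (s1 `|` s2))).
  by rewrite setDUK// subUset.
rewrite (log_massU a0 m12 mD _ Dab) ?setDIK ?subUset//.
by rewrite (log_mass_null a0 mD Dab n12) addr0.
Qed.

Lemma log_mass_mono a b s t : 0 < a -> t `<=` `[a, b] -> measurable s ->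
  measurable t -> s `<=` t -> log_mass s <= log_mass t.
Proof.
move=> a0 tab ms mt st.
have Dab : t `\` s `<=` `[a, b] by move=> r [/tab].
rewrite (@log_mass_split a b t s (t `\` s))//.
- by rewrite lerDl (log_mass_ge0 a0 Dab).
- exact: measurableD.
- by rewrite setDIK.
- by rewrite setDUK// setDv; exact: null1_set0.
Qed.

End LogMassSplit.

(** * Values of a projection function on shapes away from the camera center *)

Section Projection.
Context {R : realType} (g : set R -> R) (alpha : R).
Hypotheses (hg : projection_function g) (hnull : null_invariant g)
  (hind : independence_property g) (hscale : scale_invariant g)
  (halpha : alpha < 0)
  (hcond : g (interval_shape 1 (expR 1)) = expR alpha).
Implicit Types (s t : set R) (a b u w : R).

Lemma projection_ge0 s : ray_shape s -> 0 <= g s.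
Proof. by move=> /hg/andP[]. Qed.

Lemma projection_le1 s : ray_shape s -> g s <= 1.
Proof. by move=> /hg/andP[]. Qed.

(** Null invariance replaces [t] by [s1]|[s2], to which independence applies. It is the
    multiplicative counterpart of [log_mass_split]. *)
Lemma projection_split t s1 s2 : ray_shape t -> ray_shape s1 -> ray_shape s2 ->
  s1 `<=` t -> s2 `<=` t -> s1 `&` s2 = set0 -> null1 (t `\` (s1 `|` s2)) ->
  g t = g s1 * g s2.
Proof.
move=> rt r1 r2 s1t s2t s12 n12; rewrite -hind//.
apply: hnull => //; first exact: ray_shapeU.
rewrite [X in _ `|` X](_ : _ = set0) ?setU0//.
by apply/seteqP; split=> // r [[/s1t|/s2t]].
Qed.

Lemma diff_closure_null s t : ray_shape s -> ray_shape t ->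
  null1 (t `\` (s `|` (t `\` closure s))).
Proof.
(* A leftover point is in [closure s] but not in the open set [s], hence on the null boundary of
   [s]. *)
move=> [_ os ns] _; apply: null1S ns => r [tr nr].
have nsr : ~ s r by move=> sr; apply: nr; left.
split; last by rewrite (interior_id _).1.
by apply: contrapT => ncr; apply: nr; right.
Qed.

Lemma projectionD s t : ray_shape s -> ray_shape t -> s `<=` t ->
  g t = g s * g (t `\` closure s).
Proof.
move=> rs rt st; apply: projection_split => //; first exact: ray_shapeD.
- by apply/seteqP; split=> // r [/(@subset_closure _ s) ? [_]].
- exact: diff_closure_null.
Qed.

(** The other factor in [projectionD] is a probability, hence at most 1. *)
Lemma projection_anti s t : ray_shape s -> ray_shape t -> s `<=` t ->
  g t <= g s.
Proof.
move=> rs rt st; rewrite (projectionD rs rt st) ler_piMr//.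
  exact: projection_ge0.
by apply: projection_le1; exact: ray_shapeD.
Qed.

(** This and the next three lemmas are the side conditions shared by [projection_split] and
    [log_mass_split]; [s] is an arbitrary set so that they serve both a shape and a closed set
    [K]. *)
Lemma itv_cut_disjoint s u m w :
  (s `&` `]u, m[) `&` (s `&` `]m, w[) = set0.
Proof.
apply/seteqP; split=> // r [[_ /= rum] [_ /=]]; move: rum.
by rewrite !in_itv/= => /andP[_ rm] /andP[/(lt_trans rm)]; rewrite ltxx.
Qed.

Lemma itv_cutl s u m w : m <= w -> s `&` `]u, m[ `<=` s `&` `]u, w[.
Proof.
move=> mw r [sr]; rewrite /= !in_itv/= => /andP[ur rm].
by split=> //; rewrite ur (lt_le_trans rm).
Qed.

Lemma itv_cutr s u m w : u <= m -> s `&` `]m, w[ `<=` s `&` `]u, w[.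
Proof.
move=> um r [sr]; rewrite /= !in_itv/= => /andP[mr rw].
by split=> //; rewrite rw (le_lt_trans um).
Qed.

Lemma itv_cut_null s u m w :
  null1 ((s `&` `]u, w[) `\` ((s `&` `]u, m[) `|` (s `&` `]m, w[))).
Proof.
apply: null1S (null1_set1 m) => r [[sr]].
rewrite /= in_itv/= => /andP[ur rw] nr.
by have [rm|mr|//] := ltgtP r m; exfalso; apply: nr; [left|right];
  split=> //=; rewrite in_itv/= ?ur ?rw ?rm ?mr.
Qed.

Lemma projection_cut s u m w : ray_shape s -> 0 <= u -> u <= m -> m <= w ->
  g (s `&` `]u, w[) = g (s `&` `]u, m[) * g (s `&` `]m, w[).
Proof.
move=> rs u0 um mw; have m0 := le_trans u0 um.
by apply: projection_split; [| | |exact: itv_cutl|exact: itv_cutr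
  |exact: itv_cut_disjoint|exact: itv_cut_null];
  apply: ray_shapeI => //; exact: ray_shape_itv.
Qed.

Lemma projection_itv_cut u m w : 0 <= u -> u <= m -> m <= w ->
  g `]u, w[%classic = g `]u, m[%classic * g `]m, w[%classic.
Proof.
move=> u0 um mw.
(* Any shape containing []u, w[] would do; []0, w + 1[] is one. *)
have := projection_cut (@ray_shape_itv R 0 (w + 1) (lexx _)) u0 um mw.
rewrite !setIidr// => r /=; rewrite !in_itv/= => /andP[ur rw].
- by rewrite (le_lt_trans _ ur) ?(le_trans u0)//= (lt_trans rw)// ltrDl.
- by rewrite (le_lt_trans u0 ur) (lt_le_trans rw)// (le_trans mw)// lerDl.
- by rewrite (le_lt_trans u0 ur) (lt_trans rw)// ltrDl.
Qed.

Lemma projection_itv_scale u w (S : R) : 0 < S -> 0 <= u ->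
  g `]S * u, S * w[%classic = g `]u, w[%classic.
Proof.
move=> S0 u0; rewrite (hscale _ S0); last first.
  by apply: ray_shape_itv; rewrite mulr_ge0// ltW.
by congr g; apply/seteqP; split=> r /=; rewrite !in_itv/= !ltr_pM2l.
Qed.

Lemma projection_itv u w : 0 < u -> u <= w ->
  g `]u, w[%classic = expR (alpha * (ln w - ln u)).
Proof.
move=> u0 uw; have w0 := lt_le_trans u0 uw.
(* Scaling by [u] reduces the interval to []1, expR l[] with [l = ln w - ln u]; [hcond] is the case
   [l = 1]. *)
have uwE : w = u * expR (ln w - ln u).
  by rewrite expRB !lnK ?posrE// mulrCA divff ?mulr1// gt_eqF.
have -> : `]u, w[%classic = `]u * 1, u * expR (ln w - ln u)[%classic.
  by rewrite mulr1 -uwE.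
rewrite projection_itv_scale//.
apply: (@antitone_morphism_expR _ (fun l => g `]1, expR l[%classic)) => //.
- move=> x y x0 y0; have ex1 : 1 <= expR x by rewrite -expR0 ler_expR.
  have exy : expR x <= expR (x + y) by rewrite ler_expR lerDl.
  rewrite (projection_itv_cut ler01 ex1 exy) -{2}(mulr1 (expR x)) expRD.
  by rewrite projection_itv_scale// expR_gt0.
- move=> x y x0 xy; apply: projection_anti; [exact: ray_shape_itv..|].
  by apply: subset_itvl; rewrite bnd_simp ler_expR.
- by rewrite subr_ge0 ler_ln ?posrE.
Qed.

(** Small intervals around a boundary point of [s] still meet [s], but they avoid the closed set
    [K]; hence the mass of [K] on the right. *)
Lemma projection_le_closed a b s K :
  0 < a -> a <= b -> ray_shape s -> s `<=` `]a, b[ ->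
  closed K -> K `<=` s -> g s <= expR (alpha * log_mass K).
Proof.
move=> a0 ab rs sab cK Ks.
have mK : measurable K by exact: closed_measurable.
have Kab : K `<=` `[a, b] by move=> r /Ks/sab; exact: subset_itv_oo_cc.
pose P u w := g (s `&` `]u, w[) <= expR (alpha * log_mass (K `&` `]u, w[)).
suff : P a b by rewrite /P !setIidl//; exact: subset_trans sab.
have mKI u w : measurable (K `&` `]u, w[) by exact: measurableI.
have rsI u w : 0 <= u -> ray_shape (s `&` `]u, w[).
  by move=> u0; apply: ray_shapeI => //; exact: ray_shape_itv.
apply: (@cousin _ a b P ab).
- move=> u m w au um mw wb Pum Pmw; have u0 := le_trans (ltW a0) au.
  rewrite /P (projection_cut rs u0 um mw).
  rewrite (@log_mass_split _ a b _ (K `&` `]u, m[) (K `&` `]m, w[))//.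
  + by rewrite mulrDr expRD ler_pM// projection_ge0//; apply: rsI;
      rewrite ?(le_trans u0).
  + by move=> r [/Kab].
  + exact: itv_cutl.
  + exact: itv_cutr.
  + exact: itv_cut_disjoint.
  + exact: itv_cut_null.
- move=> p /andP[ap pb]; have [sp|nsp] := pselect (s p).
  + have : nbhs p s by case: rs => _ os _; exact: open_nbhs_nbhs.
    move=> /nbhs_ballP[d /= d0 ds]; exists d => // u w au pu up pw wp wb.
    have u0 := lt_le_trans a0 au; have uw := le_trans up pw.
    have uws : `]u, w[ `<=` s.
      move=> r /=; rewrite in_itv/= => /andP[ur rw]; apply: ds.
      by rewrite /ball/= ltr_norml; apply/andP; split; lra.
    (* The left side is now exact, and the negative [alpha] reverses the comparison of masses. *)
    rewrite /P (setIidr uws) projection_itv// ler_expR ler_nM2l//.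
    rewrite -log_mass_itv//.
    apply: (@log_mass_mono _ u w) => //; exact: subset_itv_oo_cc.
  + have : nbhs p (~` K).
      apply: open_nbhs_nbhs; split; first exact: closed_openC.
      by move=> /Ks.
    move=> /nbhs_ballP[d /= d0 dK]; exists d => // u w au pu up pw wp wb.
    (* Empty intersection: the bound is [expR 0], and a probability is at most 1. *)
    rewrite /P (_ : K `&` `]u, w[ = set0).
      rewrite /log_mass Rintegral_set0 mulr0 expR0.
      by apply: projection_le1; apply: rsI; exact: le_trans (ltW a0) au.
    apply/seteqP; split=> // r [Kr]; rewrite /= in_itv/= => /andP[ur rw].
    apply: (dK r) => //.
    by rewrite /ball/= ltr_norml; apply/andP; split; lra.
Qed.

Lemma projection_le a b s : 0 < a -> a <= b -> ray_shape s -> s `<=` `]a, b[ ->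
  g s <= expR (alpha * log_mass s).
Proof.
move=> a0 ab rs sab; rewrite leNgt; apply/negP => gs.
have gs0 : 0 < g s by apply: lt_trans gs; exact: expR_gt0.
move: (gs); rewrite -[g s]lnK ?posrE// ltr_expR => yx.
set y := ln (g s) in yx; set x := alpha * log_mass s in yx.
have ms := ray_shape_measurable rs.
have sab' : s `<=` `[a, b] by move=> r /sab; exact: subset_itv_oo_cc.
(* The loss of mass from [s] to [K] for which the bound for [K] would equal [g s]; any smaller loss
   gives a contradiction. *)
have e0 : 0 < (y - x) / (- alpha) by rewrite divr_gt0 ?subr_gt0 ?oppr_gt0.
set e := _ / _ in e0.
have mufin : (lebesgue_measure s < +oo)%E.
  apply: (@le_lt_trans _ _ (lebesgue_measure `[a, b]%classic)).
    by apply: le_measure; rewrite ?inE.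
  by rewrite lebesgue_measure_itv/=; case: ifP => _; rewrite ltry.
(* Measure tolerance [a * e], since [log_mass_le] then costs a factor [a^-1]. *)
have [K [cK Ks muK]] := lebesgue_regularity_inner ms mufin (mulr_gt0 a0 e0).
have clK : closed K by apply: compact_closed => //; exact: Rhausdorff.
have mK : measurable K by exact: closed_measurable.
have mD : measurable (s `\` K) by exact: measurableD.
have Dab : s `\` K `<=` `[a, b] by move=> r [/sab'].
have sE : log_mass s = log_mass K + log_mass (s `\` K).
  apply: (@log_mass_split _ a b) => //.
  by rewrite setDIK.
  by rewrite setDUK// setDv; exact: null1_set0.
have De : log_mass (s `\` K) < e.
  apply: le_lt_trans (log_mass_le a0 mD Dab) _.
  rewrite mulrC ltr_pdivrMr// mulrC -lte_fin fineK// ge0_fin_numE//.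
  exact: lt_trans muK (ltry _).
have := projection_le_closed a0 ab rs sab clK Ks.
rewrite -[g s]lnK ?posrE// ler_expR -/y leNgt => /negP; apply.
have -> : y = x - alpha * e by rewrite /e; field; rewrite lt_eqF.
by rewrite /x sE mulrDr -addrA ltrDl -mulrBr nmulr_rgt0// subr_lt0.
Qed.

Lemma projectionE a b s : 0 < a -> a <= b -> ray_shape s -> s `<=` `]a, b[ ->
  g s = expR (alpha * log_mass s).
Proof.
move=> a0 ab rs sab.
have rab := @ray_shape_itv R a b (ltW a0).
have rD := ray_shapeD rab rs.
apply/eqP; rewrite eq_le (projection_le a0 ab rs sab)/= leNgt.
apply/negP => lt_gs.
have Dab : `]a, b[ `\` closure s `<=` `]a, b[ by exact: subDsetl.
(* A strict deficit of [g s] cannot be made up by the complementary shape, itself bounded above by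
   [projection_le]; the product would fall below the exact value on []a, b[]. *)
have := projectionD rs rab sab; apply/eqP.
rewrite gt_eqF// projection_itv// -log_mass_itv//.
rewrite (@log_mass_split _ a b _ s (`]a, b[ `\` closure s))//.
- rewrite mulrDr expRD.
  apply: (@le_lt_trans _ _
    (g s * expR (alpha * log_mass (`]a, b[ `\` closure s)))).
    by rewrite ler_wpM2l ?projection_ge0// (projection_le a0 ab rD Dab).
  by rewrite ltr_pM2r// expR_gt0.
- exact: subset_itv_oo_cc.
- exact: ray_shape_measurable.
- exact: ray_shape_measurable.
- by apply/seteqP; split=> // r [/(@subset_closure _ s) ? [_]].
- exact: diff_closure_null.
Qed.

End Projection.

(** * From a 3D shape to its trace on a ray *)

Section RayMass.
Context {R : realType}.
Implicit Types (c x : R * R * R) (v Theta : set (R * R * R)).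

(** Membership in the visible region gives [r *: x = q *: y] with a possibly different direction
    [y]; squared Euclidean norms yield [r = q]. *)
Lemma shape_in_ray_bounded c Theta (Rmin Rmax : R) v x :
  Theta `<=` @unit_sphere R -> 0 < Rmin -> Theta x ->
  v `<=` visible_region c Theta Rmin Rmax ->
  shape_in_ray v c x `<=` `[Rmin, Rmax].
Proof.
move=> Tsphere Rmin0 /Tsphere xs vsub r.
move=> [r0 /vsub[y [q [/Tsphere ys /andP[q1 q2] /addrI rxqy]]]].
suff -> : r = q by rewrite /= in_itv/= q1.
have q0 : 0 <= q by rewrite (le_trans _ q1)// ltW.
apply/eqP; rewrite -(@eqrXn2 _ 2)//; apply/eqP.
move: rxqy xs ys; case: x y => [[x1 x2] x3] [[y1 y2] y3].
rewrite /unit_sphere/= => -[e1 e2 e3] xs ys.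
transitivity ((r * x1) ^+ 2 + (r * x2) ^+ 2 + (r * x3) ^+ 2).
  by rewrite !exprMn -!mulrDr xs mulr1.
transitivity ((q * y1) ^+ 2 + (q * y2) ^+ 2 + (q * y3) ^+ 2).
  by congr (_ ^+ 2 + _ ^+ 2 + _ ^+ 2).
by rewrite !exprMn -!mulrDr ys mulr1.
Qed.

Lemma ray_massE (a b : R) v c x : 0 < a -> ray_shape (shape_in_ray v c x) ->
  shape_in_ray v c x `<=` `[a, b] ->
  ray_mass v c x = (log_mass (shape_in_ray v c x))%:E.
Proof.
move=> a0 rs sab; set s := shape_in_ray v c x in rs sab *.
have ms := ray_shape_measurable rs.
have s0 : s `<=` `[0, +oo[ by case: rs.
(* The integral is finite since [s] stays away from 0, so passing to a real number loses nothing. *)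
rewrite /log_mass /Rintegral fineK; last first.
  exact: integrable_fin_num (inv_integrable a0 ms sab).
rewrite -[in RHS](setIidr s0) integral_mkcondr epatch_indic.
by apply: eq_integral => r _; rewrite EFinM muleC.
Qed.

End RayMass.

Unset Implicit Arguments.
Set Strict Implicit.

Theorem proposition2 (R : realType)
    (c : R * R * R) (Theta : set (R * R * R)) (Rmin Rmax : R)
    (hTheta : Theta `<=` @unit_sphere R) (hRmin : 0 < Rmin)
    (g : set R -> R)
    (hg : projection_function g) (hnull : null_invariant g)
    (hind : independence_property g) (hscale : scale_invariant g)
    (alpha : R) (halpha : alpha < 0)
    (hcond : g (interval_shape 1 (expR 1)) = expR alpha)
    (v : set (R * R * R)) (hv : shape3 c Theta Rmin Rmax v)
    (x : R * R * R) (hx : Theta x) (hvx : ray_shape (shape_in_ray v c x)) :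
  (g (shape_in_ray v c x))%:E = expeR (alpha%:E * ray_mass v c x)%E.
Proof.
have [vsub _ _] := hv.
have sab := shape_in_ray_bounded hTheta hRmin hx vsub.
rewrite (ray_massE hRmin hvx sab)/=; congr (_%:E).
(* An open interval containing [[Rmin, Rmax]] is needed, with a positive left end; the maximum keeps
   its ends ordered even if [Rmax < Rmin]. *)
have Rmin2 : 0 < Rmin / 2 by rewrite divr_gt0.
apply: (@projectionE _ _ _ hg hnull hind hscale halpha hcond _
  (Num.max Rmin Rmax + 1) _ Rmin2) => //.
  have := le_max Rmin Rmin Rmax; rewrite lexx/=; lra.
move=> r /sab; rewrite /= !in_itv/= => /andP[r1 r2]; apply/andP.
split; first lra.
have := le_max Rmax Rmin Rmax; rewrite lexx orbT; lra.
Qed.
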